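(* Every fan has the Jure property. That is, if $X$ is a fan, then $X$ has a basis consisting of pierced open sets.
   Context: A continuum is a non-empty compact connected metric space. An arc is a space homeomorphic to $[0,1]$. A continuum $X$ is a fan if: (1) there exist $v\in X$ and a collection of arcs $\mathcal L$ such that $X=\bigcup\mathcal L$ and $L\cap L'=\{v\}$ for every two (distinct) elements $L,L'\in\mathcal L$; and (2) for every two subcontinua $H$ and $K$ of $X$, the intersection $H\cap K$ is connected (the empty set counts as connected). Let $X$ be a fan and let $U\subset X$ be open. A point $x\in\partial U$ is a piercing point for $U$ if for every open set $V\subset X$ containing $x$, and every arc $\alpha\subset X$ which goes through $x$ (meaning $x\in\alpha$ and $x$ is not an endpoint of $\alpha$), the set $\alpha\cap V$ intersects both $U$ and $X\setminus\overline U$. The open set $U$ is pierced if every point of $\partial U$ is a piercing point for $U$. (Boundaries and closures are taken in $X$.) The space $X$ has the Jure property if $X$ has a basis of pierced open sets. *)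

(* Defs.v *)
From HB Require Import structures.
From mathcomp Require Import all_boot all_order all_algebra.
From mathcomp Require Import all_classical all_reals topology normedtype.

Set Implicit Arguments.
Unset Strict Implicit.
Unset Printing Implicit Defensive.

Import Order.TTheory GRing.Theory Num.Theory.
Import numFieldNormedType.Exports.

Local Open Scope classical_set_scope.
Local Open Scope ring_scope.

Definition homeomorphism_on (S T : topologicalType) (A : set S) (B : set T)
    (f : S -> T) :=
  [/\ set_bij A B f, {within A, continuous f} &
      exists2 g : T -> S, {in A, cancel f g} & {within B, continuous g}].

Definition boundary (T : topologicalType) (U : set T) : set T :=
  closure U `&` closure (~` U).

Section fan.
Context {R : realType} {X : metricType R}.
Implicit Types (A L H K U V : set X) (x v : X).

(* A subset of X, seen as a space of its own; compactness and connectedness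
   do not depend on the ambient space. *)
Definition is_continuum A := [/\ A !=set0, compact A & connected A].

Definition arc_param A (f : R -> X) := homeomorphism_on (`[0, 1] : set R) A f.

Definition is_arc A := exists f : R -> X, arc_param A f.

(* The endpoints do not depend on the parametrization f. *)
Definition arc_endpoint A x :=
  exists2 f : R -> X, arc_param A f & x = f 0 \/ x = f 1.

Definition goes_through A x := A x /\ ~ arc_endpoint A x.

Definition piercing_point U x :=
  boundary U x /\
  forall V, open V -> V x ->
  forall A, is_arc A -> goes_through A x ->
    A `&` V `&` U !=set0 /\ A `&` V `&` ~` closure U !=set0.

Definition pierced U := forall x, boundary U x -> piercing_point U x.

End fan.

Section fan_space.
Context {R : realType} (X : metricType R).

Definition is_fan :=
  [/\ is_continuum [set: X],
      exists v : X, exists LL : set (set X),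
        [/\ forall L, LL L -> is_arc L,
            \bigcup_(L in LL) L = [set: X] &
            forall L L', LL L -> LL L' -> L <> L' -> L `&` L' = [set v]] &
      forall H K : set X, is_continuum H -> is_continuum K ->
        connected (H `&` K)].

Definition Jure_property :=
  exists2 B : set (set X), basis B & forall U, B U -> pierced U.

End fan_space.

(* Main.v *)
Require Import Defs.
From mathcomp Require Import all_boot all_order all_algebra.
From mathcomp Require Import all_classical all_reals topology normedtype.
From mathcomp Require Import ring lra.

Set Implicit Arguments.
Unset Strict Implicit.
Unset Printing Implicit Defensive.

Import Order.TTheory GRing.Theory Num.Theory.
Import numFieldNormedType.Exports.

Local Open Scope classical_set_scope.
Local Open Scope ring_scope.

(** Fix a point x0 of the fan X with vertex v, put f := d(x0, -), and choose
   0 < a < b small with f v outside [a, b]. In the band K := {a <= f <= b} look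
   for a continuous c : K -> ]a, b[ that is constant on the connected subsets
   of K, and set U := {f < a} `|` {f < c}. Every boundary point x of U lies in
   K and satisfies f x = c x. Suppose that x is not a piercing point: a short
   piece B of some arc through x stays in K and misses U, or misses the open
   set {f > c}. Since c is constant on B, the function - f or f then has a
   maximum over B at the interior point x of B. So U is pierced as soon as the
   value of c on each component of K avoids the local extreme values that f has
   there.

   One component of K is easy. Since X is hereditarily unicoherent, a
   subcontinuum that misses v lies inside a single leg
   ([continuum_in_leg]), and a function on an arc has only finitely many values
   at local maxima that dominate a window of given size. What has to be arranged
   is a choice of c that is continuous across the uncountably many components.
   For this, local maxima are sorted into countably many classes of peaks, one
   for each n: a peak has points p, q on its two sides, each at distance at
   least 1/n from the part of the sublevel set that leads from the peak to the
   other one. The distance condition makes each class compact ([closed_peak]):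
   without it, the two sides of a hairpin turn could collapse onto one arc in
   the limit. It also keeps p and q on different sides, so that every peak in
   the n-th class is an honest maximum over a window of the leg whose size
   depends only on n and the leg ([peak_window]), and the class takes finitely many values
   on each component ([peak_values_finite]).

   By compactness, a value avoided on one component can be kept on a relatively
   clopen neighbourhood of it. Hence a locally constant c can be moved by an
   arbitrarily small amount to a locally constant function that avoids one class
   ([locally_constant_avoid]), and by compactness of the class it then stays at a
   positive distance ([locally_constant_gap]). Treating the classes one after
   the other with steps that shrink fast enough gives c as a uniform limit of
   locally constant functions ([avoid_countably_many]).

   The components of K are handled through the relation [linked], whose classes
   are the quasi-components: it passes to limits, and its classes are connected
   when the set is compact ([linked_limit], [connected_linked_set]). *)

(** * Quasi-components of compact sets *)

(** The covering form of compactness as an induction principle: a property that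
   is inherited by subsets and by finite unions passes from local to global. *)
Lemma compact_ideal (T : topologicalType) (K : set T) (P : set T -> Prop) :
  compact K -> P set0 ->
  (forall A B, A `<=` B -> P B -> P A) ->
  (forall A B, P A -> P B -> P (A `|` B)) ->
  (forall x, K x -> exists2 A, nbhs x A & P A) ->
  P K.
Proof.
move=> cK P0 Psub PU Ploc; apply: contrapT => nPK.
pose F := [set A | P (K `\` A)].
have FF : ProperFilter F.
  split; first by rewrite /F/= setD0.
  split => [|A B PA PB|A B AB PA].
  - by rewrite /F/= setDT.
  - by rewrite /F/= setDIr; exact: PU.
  - by apply: Psub PA; exact: setDS.
have FK : F K by rewrite /F/= setDv.
have [x [Kx Fx]] := cK F FF FK.
have [A Ax PA] := Ploc x Kx.
have FnA : F (~` A) by apply: Psub PA; rewrite setDE setCK; exact: subIsetr.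
by have [y []] := Fx _ _ FnA Ax.
Qed.

Section linked.
Context {T : topologicalType}.
Implicit Types (M N A : set T) (x y z : T).

(** Being in the same quasi-component of [M]. Separations are taken by open sets
   of the ambient space rather than by clopen subsets of [M], so that one
   separation of [M] is also a separation of all sets close to [M]. *)
Definition linked M x y := [/\ M x, M y &
  forall U V, open U -> open V -> U `&` V = set0 -> M `<=` U `|` V ->
    U x -> V y -> False].

Lemma linked_refl M x : M x -> linked M x x.
Proof.
move=> Mx; split=> // U V _ _ UV _ Ux Vx.
by have : (U `&` V) x by []; rewrite UV.
Qed.

Lemma linked_trans M y x z : linked M x y -> linked M y z -> linked M x z.
Proof.
move=> [Mx My xy] [_ Mz yz]; split=> // U V oU oV UV MUV Ux Vz.
by have [Uy|Vy] := MUV _ My; [exact: yz Uy Vz|exact: xy Ux Vy].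
Qed.

Lemma linkedS M N x y : M `<=` N -> linked M x y -> linked N x y.
Proof.
move=> MN [Mx My xy]; split; [exact: MN|exact: MN|] => U V oU oV UV NUV.
by apply: xy => //; exact: subset_trans NUV.
Qed.

Lemma connected_linked M A x y :
  connected A -> A `<=` M -> A x -> A y -> linked M x y.
Proof.
move=> cA AM Ax Ay; split; [exact: AM|exact: AM|] => U V oU oV UV MUV Ux Vy.
have eqA : A `&` U = A.
  apply: cA; first by exists x.
  - by exists U.
  - exists (~` V); first exact: open_closedC.
    apply/seteqP; split => z [Az].
      by move=> Uz; split=> // Vz; have : (U `&` V) z by []; rewrite UV.
    by move=> nVz; split => //; have [] := MUV _ (AM _ Az).
have : (U `&` V) y by split => //; move: Ay; rewrite -eqA => -[].
by rewrite UV.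
Qed.

Lemma closed_linked M x : closed M -> closed (linked M x).
Proof.
move=> cM; rewrite closure_id; apply/seteqP; split; first exact: subset_closure.
move=> y cy; have [z0 [[Mx _ _] _]] := cy setT filterT.
split=> //.
  rewrite [M](closure_id _).1//.
  by apply: closureS cy => z -[].
move=> U V oU oV UV MUV Ux Vy.
by have [z [[_ _ xz] Vz]] := cy V (open_nbhs_nbhs (conj oV Vy)); exact: xz Ux Vz.
Qed.

(** Each point of [M] outside [O] is split off from [x] by some separation of
   [M]; finitely many of these suffice, and they intersect to a single one. *)
Lemma linked_nbhs M O x : compact M -> M x -> open O -> linked M x `<=` O ->
  exists U V, [/\ open U, open V, U `&` V = set0, M `<=` U `|` V &
    U x /\ M `&` U `<=` O].
Proof.
move=> cM Mx oO xO.
pose P (S : set T) := exists U V,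
  [/\ open U, open V, U `&` V = set0, M `<=` U `|` V & U x /\ S `<=` V].
suff [U [V [oU oV UV MUV [Ux SV]]]] : P (M `&` ~` O).
  exists U, V; split => //; split => // y [My Uy].
  apply: contrapT => nOy; have : (U `&` V) y by split=> //; exact: SV.
  by rewrite UV.
apply: compact_ideal.
- by apply: compact_closedI => //; exact: open_closedC.
- exists setT, set0; split; [exact: openT|exact: open0| | |].
  + by rewrite setI0.
  + by rewrite setU0.
  + by split.
- move=> A B AB [U [V [oU oV UV MUV [Ux SV]]]].
  by exists U, V; split=> //; split=> //; exact: subset_trans SV.
- move=> A B [U [V [oU oV UV MUV [Ux SV]]]] [U' [V' [oU' oV' UV' MUV' [Ux' SV']]]].
  exists (U `&` U'), (V `|` V'); split.
  + exact: openI.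
  + exact: openU.
  + rewrite -subset0 => y [[Uy Uy'] [Vy|Vy]].
      by rewrite -UV.
    by rewrite -UV'.
  + move=> y My; have [Uy|Vy] := MUV _ My; last by right; left.
    by have [Uy'|Vy] := MUV' _ My; [left|right; right].
  + by split=> // y [/SV|/SV']; [left|right].
- move=> y [My nOy].
  apply: contrapT => H; apply: nOy; apply: xO; split=> // U V oU oV UV MUV Ux Vy.
  apply: H; exists V; first exact: open_nbhs_nbhs.
  by exists U, V; split=> //; split.
Qed.

(** In a compact space quasi-components coincide with components. If the class of
   [x] broke into two closed halves, disjoint neighbourhoods of the halves would
   cover a clopen part of [M] around [x] by [linked_nbhs], and hence separate
   [x] from one of the halves. *)
Lemma connected_linked_set M x : hausdorff_space T -> compact [set: T] ->
  closed M -> connected (linked M x).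
Proof.
move=> hT cT cM.
have [Mx|nMx] := pselect (M x); last first.
  suff -> : linked M x = set0 by exact: connected0.
  by rewrite -subset0 => y [].
have kM : compact M by apply: subclosed_compact cT _.
set Q := linked M x; have cQ : closed Q by exact: closed_linked.
have Qx : Q x by exact: linked_refl.
move=> B [b Bb] [C oC BC] [D cD BD].
(* both halves of the splitting are closed, hence separated by open sets *)
have cB : closed B by rewrite BD; exact: closedI.
have cB' : closed (Q `&` ~` C) by apply: closedI => //; exact: open_closedC.
have BB' : B `&` (Q `&` ~` C) = set0.
  by rewrite -subset0 BC => y [[_ Cy] [_ /(_ Cy)]].
have nbB : set_nbhs B (~` (Q `&` ~` C)).
  move=> z Bz; apply: open_nbhs_nbhs; split; first exact: closed_openC.
  by move=> B'z; have : (B `&` (Q `&` ~` C)) z by []; rewrite BB'.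
have [N BN NB'] := compact_normal hT cT cB nbB.
pose G := N°; pose H := ~` closure N.
have oG : open G by exact: open_interior.
have oH : open H by exact/closed_openC/closed_closure.
have BG : B `<=` G by move=> z Bz; exact: BN.
have B'H : Q `&` ~` C `<=` H by move=> z B'z /NB'; exact.
have GH : G `&` H = set0.
  by rewrite -subset0 => z [/interior_subset/subset_closure].
have QGH : Q `<=` G `|` H.
  move=> y Qy; have [Cy|nCy] := pselect (C y).
    by left; apply: BG; rewrite BC.
  by right; exact: B'H.
have [U [V [oU oV UV MUV [Ux UGH]]]] := linked_nbhs kM Mx (openU oG oH) QGH.
(* U splits further along G and H, and no splitting separates points of Q *)
have split_absurd G' H' y : open G' -> open H' -> G' `&` H' = set0 ->
    M `&` U `<=` G' `|` H' -> G' x -> Q y -> H' y -> False.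
  move=> oG' oH' GH' UGH' Gx [_ My xy] Hy.
  apply: (xy (U `&` G') (V `|` H')) => //.
  - exact: openI.
  - exact: openU.
  - rewrite -subset0 => z [[Uz Gz] [Vz|Hz]]; first by rewrite -UV.
    by rewrite -GH'.
  - move=> z Mz; have [Uz|Vz] := MUV _ Mz; last by right; left.
    by have [Gz|Hz] := UGH' _ (conj Mz Uz); [left|right; right].
  - by right.
apply/seteqP; split=> [y|y Qy]; first by rewrite BC => -[].
apply: contrapT => nBy.
have Hy : H y by apply: B'H; split => // Cy; apply: nBy; rewrite BC.
have Qb : Q b by move: Bb; rewrite BC => -[].
have [Gx|Hx] := QGH _ Qx.
  exact: (split_absurd G H y).
apply: (split_absurd H G b) => //; first by rewrite setIC.
- by rewrite setUC.
- exact: BG.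
Qed.

End linked.

(** The limit [M0] may be larger than the limit of the sets [M i], never smaller:
   so a separation of [M0] by open sets separates almost all [M i]. *)
Lemma linked_limit (T : topologicalType) (I : Type) (F : set_system I)
    (M : I -> set T) (M0 : set T) (x y : I -> T) (x0 y0 : T) :
  compact [set: T] -> ProperFilter F ->
  (forall z, ~ M0 z -> \forall z' \near z & i \near F, ~ M i z') ->
  x @ F --> x0 -> y @ F --> y0 ->
  (\forall i \near F, linked (M i) (x i) (y i)) -> linked M0 x0 y0.
Proof.
move=> cT FF usc xx0 yy0 lF.
have inM0 (z : I -> T) z0 : z @ F --> z0 -> (\forall i \near F, M i (z i)) -> M0 z0.
  move=> zz0 Mz; apply: contrapT => /usc [[A B] [/= Az0 FB] AB].
  have [i [[Bi Ai] Mi]] := filter_ex (filterI (filterI FB (zz0 _ Az0)) Mz).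
  exact: (AB (z i, i)).
split; first by apply: (inM0 x x0 xx0); apply: filterS lF => i -[].
  by apply: (inM0 y y0 yy0); apply: filterS lF => i -[].
move=> U V oU oV UV MUV Ux0 Vy0.
have cC : compact (~` (U `|` V)).
  by apply: subclosed_compact cT _ => //; apply: open_closedC; exact: openU.
have /compact_near_coveringP ncC := cC.
have FM : \forall i \near F, ~` (U `|` V) `<=` ~` M i.
  by apply: ncC => z nz; apply: usc => /MUV.
have FU := xx0 _ (open_nbhs_nbhs (conj oU Ux0)).
have FV := yy0 _ (open_nbhs_nbhs (conj oV Vy0)).
have [i [[[FMi FUi] FVi] [_ _ xyi]]] :=
  filter_ex (filterI (filterI (filterI FM FU) FV) lF).
apply: xyi FUi FVi => // z Mz; apply: contrapT => nz; exact: FMi nz Mz.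
Qed.

(** * Peaks *)

Section peaks.
Context {R : realType} {X : metricType R}.
Implicit Types (K A : set X) (f : X -> R) (e : R) (x p q : X).

Let fst_continuous (U V : topologicalType) : continuous (@fst U V).
Proof. by move=> t; exact: cvg_fst. Qed.

Let snd_continuous (U V : topologicalType) : continuous (@snd U V).
Proof. by move=> t; exact: cvg_snd. Qed.

Lemma mdist_continuous : continuous (fun u : X * X => mdist u.1 u.2).
Proof.
move=> [x y] /=; apply/cvgrPdist_lt => e e0.
have e20 : 0 < e / 2 by rewrite divr_gt0.
exists (ball x (e / 2), ball y (e / 2)) => /=.
  by split; exact: nbhsx_ballx.
move=> [x' y'] /=; rewrite !ballEmdist /= => -[xx' yy'].
have := metric_triangle x x' y; have := metric_triangle x' y' y.
have := metric_triangle x' x y'; have := metric_triangle x y y'.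
rewrite (metric_sym y' y) (metric_sym x' x) ltr_norml; lra.
Qed.

Lemma mdistl_continuous x : continuous (mdist x).
Proof.
move=> z; apply: (continuous_comp (f := fun z => (x, z))
  (g := fun u => mdist u.1 u.2)); last exact: mdist_continuous.
by apply: cvg_pair; [exact: cvg_cst|exact: cvg_id].
Qed.

Definition sublevel K f e x q :=
  K `&` [set y | f y <= f x /\ e <= mdist q y].

(** The points where [f] has a maximum over a piece of arc from [p] to [q],
   [x] being strictly between. The arc itself is replaced by two links, from [x] to
   [p] and from [x] to [q] inside the set where [f] does not exceed [f x]. Each
   of them keeps the distance [e] from the end of the other: this forbids that
   one is part of the other, and it is a closed condition. *)
Definition peak K f e x := exists p q,
  linked (sublevel K f e x q) x p /\ linked (sublevel K f e x p) x q.

Lemma sublevel_usc K f e x0 q0 z : closed K -> continuous f ->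
  ~ sublevel K f e x0 q0 z ->
  \forall z' \near z & t \near (x0, q0), ~ sublevel K f e t.1 t.2 z'.
Proof.
move=> cK cf nz; have [Kz|nKz] := pselect (K z); last first.
  exists (~` K, setT) => /=; last by move=> [z' t] /= [nKz' _] [].
  by split; [apply: open_nbhs_nbhs; split => //; exact: closed_openC|exact: filterT].
have [fz|fz] := leP (f z) (f x0); last first.
  pose m := (f z + f x0) / 2.
  exists (f @^-1` [set r | m < r], [set t | f t.1 < m]) => /=.
    split; first by apply: (cvgr_gt _ (cf z)); rewrite /m; lra.
    have : (fun t : X * X => f t.1) @ (x0, q0) --> f x0.
      by apply: (@continuous_comp _ _ _ fst f (x0, q0)); [exact: fst_continuous|exact: cf].
    by move=> /cvgr_lt; apply; rewrite /m; lra.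
  by move=> [z' t] /= [mz tm] [_ [/= ? _]]; lra.
have [ez|ez] := leP e (mdist q0 z); first by exfalso; apply: nz.
have [[A B] /= [Aq Bz] AB] : nbhs (q0, z) [set u | mdist u.1 u.2 < e].
  by have /cvgr_lt := @mdist_continuous (q0, z); apply.
exists (B, snd @^-1` A) => /=.
  by split => //; exact: snd_continuous.
by move=> [z' t] /= [Bz' At] [_ [_ /=]]; rewrite leNgt (AB (t.2, z')).
Qed.

(** The triples (x, p, q) that witness a peak form a closed set by
   [linked_limit], and the peaks are its projection. *)
Lemma closed_peak K f e : compact [set: X] -> closed K -> continuous f ->
  closed (peak K f e).
Proof.
move=> cX cK cf.
pose S (t : X * X * X) := linked (sublevel K f e t.1.1 t.2) t.1.1 t.1.2 /\
  linked (sublevel K f e t.1.1 t.1.2) t.1.1 t.2.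
have cS : closed S.
  move=> t0 clS; have FF : ProperFilter (within S (nbhs t0)).
    exact: within_nbhs_proper.
  have FS : \forall t \near within S (nbhs t0), S t by exact: withinT.
  have cvgF (g : X * X * X -> X) : g @ t0 --> g t0 ->
      g @ within S (nbhs t0) --> g t0.
    by move=> gt0; apply: cvg_trans gt0; apply: cvg_app; exact: cvg_within.
  have c1 : (fun t : X * X * X => t.1.1) @ t0 --> t0.1.1.
    by apply: (@continuous_comp _ _ _ fst fst); exact: fst_continuous.
  have c2 : (fun t : X * X * X => t.1.2) @ t0 --> t0.1.2.
    by apply: (@continuous_comp _ _ _ fst snd); [exact: fst_continuous|exact: snd_continuous].
  have c3 : (fun t : X * X * X => t.2) @ t0 --> t0.2 by exact: snd_continuous.
  have usc (g : X * X * X -> X) z : g @ t0 --> g t0 ->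
      ~ sublevel K f e t0.1.1 (g t0) z ->
      \forall z' \near z & t \near within S (nbhs t0),
        ~ sublevel K f e t.1.1 (g t) z'.
    move=> gt0 /(sublevel_usc cK cf) [[A B] /= [Az [[B1 B2] /= [B1x B2g] B12]] AB].
    exists (A, [set t | B1 t.1.1 /\ B2 (g t)]) => /=.
      split=> //; apply: cvg_within; apply: filterI; first exact: c1.
      exact: gt0.
    move=> [z' t] /= [Az' [Bt Bt']]; apply: (AB (z', (t.1.1, g t))) => /=.
    by split=> //; exact: B12.
  split.
  - apply: (linked_limit (F := within S (nbhs t0))
      (M := fun t => sublevel K f e t.1.1 t.2) cX) => //.
    + by move=> z; exact: (usc (fun t => t.2)).
    + exact: (cvgF (fun t => t.1.1)).
    + exact: (cvgF (fun t => t.1.2)).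
    + by apply: filterS FS => t [].
  - apply: (linked_limit (F := within S (nbhs t0))
      (M := fun t => sublevel K f e t.1.1 t.1.2) cX) => //.
    + by move=> z; exact: (usc (fun t => t.1.2)).
    + exact: (cvgF (fun t => t.1.1)).
    + exact: (cvgF (fun t => t.2)).
    + by apply: filterS FS => t [].
have -> : peak K f e = (fun t : X * X * X => t.1.1) @` S.
  apply/seteqP; split => [x [p [q xpq]]|_ [[[x p] q] xpq <-]].
    by exists (x, p, q).
  by exists p, q.
apply: compact_closed; first exact: metric_hausdorff.
apply: continuous_compact; first apply: continuous_subspaceT.
  by move=> t; apply: (@continuous_comp _ _ _ fst fst); exact: fst_continuous.
apply: (subclosed_compact cS (compact_setX (compact_setX cX cX) cX)).
by move=> t _.
Qed.

(** * Peaks along an arc *)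

Lemma arc_coordinate A (h : R -> X) : arc_param A h ->
  exists g : X -> R, [/\ {within `[0, 1], continuous h}, {within A, continuous g},
    forall s, `[0, 1]%classic s -> A (h s) /\ g (h s) = s &
    forall z, A z -> `[0, 1]%classic (g z) /\ h (g z) = z].
Proof.
move=> [[hA _ surjh] ch [g gK cg]]; exists g; split=> // [s s01|z Az].
  by split; [exact: hA | apply: gK; rewrite inE].
by have [s s01 <-] := surjh _ Az; rewrite gK ?inE.
Qed.

Lemma arc_continuum A : is_arc A -> is_continuum A.
Proof.
move=> [h [[hA _ surjh] ch _]].
have -> : A = h @` `[0, 1].
  by apply/seteqP; split=> // _ [s s01 <-]; exact: hA.
split.
- by exists (h 0), 0 => //=; rewrite in_itv/= lexx ler01.
- by apply: continuous_compact => //; exact: segment_compact.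
- by apply: connected_continuous_connected => //; exact: segment_connected.
Qed.

Lemma segment_uniformly_continuous (h : R -> X) e :
  {within `[0, 1], continuous h} -> 0 < e ->
  exists2 d : R, 0 < d & forall s t : R, `[0, 1]%classic s -> `[0, 1]%classic t ->
    `|s - t| < d -> mdist (h s) (h t) < e.
Proof.
move=> /subspace_continuousP ch e0.
pose P (S : set R) := exists2 d : R, 0 < d & forall s t : R, S s ->
  `[0, 1]%classic s -> `[0, 1]%classic t -> `|s - t| < d -> mdist (h s) (h t) < e.
suff [d d0 hd] : P `[0, 1]%classic by exists d => // s t s1; exact: hd.
apply: compact_ideal; first exact: segment_compact.
- by exists 1.
- by move=> A B AB [d d0 hd]; exists d => // s t /AB; exact: hd.
- move=> A B [d d0 hd] [d' d'0 hd']; exists (Num.min d d').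
    by rewrite lt_min d0 d'0.
  move=> s t ABs s1 t1; rewrite lt_min => /andP[? ?].
  by case: ABs => ?; [exact: hd|exact: hd'].
- move=> s s1; have e20 : 0 < e / 2 by rewrite divr_gt0.
  have /metricType_numDomainType.cvgrPdist_lt/(_ _ e20) := ch s s1.
  move=> [r /= r0 hr]; exists (ball s (r / 2)).
    by apply: nbhsx_ballx; rewrite divr_gt0.
  exists (r / 2); first by rewrite divr_gt0.
  move=> u t; rewrite /ball/= => us u1 t1 ut.
  have hu : mdist (h s) (h u) < e / 2 by apply: hr => //=; lra.
  have ht : mdist (h s) (h t) < e / 2.
    apply: hr => //=; have := ler_normD (s - u) (u - t).
    have -> : s - u + (u - t) = s - t by ring.
    lra.
  have := metric_triangle (h u) (h s) (h t).
  rewrite (metric_sym (h u) (h s)); lra.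
Qed.

(** Along an arc, the two links of a peak [y] are intervals around [g y]. Neither
   contains the end of the other, so these ends lie on opposite sides of [g y];
   both are at distance at least [e] from [y], hence at parameter distance at
   least [d] by uniform continuity of [h]. *)
Lemma peak_window K f e A (h : R -> X) (g : X -> R) : compact [set: X] -> closed K ->
  continuous f -> 0 < e -> {within `[0, 1], continuous h} ->
  {within A, continuous g} ->
  (forall z, A z -> `[0, 1]%classic (g z) /\ h (g z) = z) ->
  exists2 d : R, 0 < d & forall (y : X) (t : R), peak K f e y -> linked K y `<=` A ->
    `[0, 1]%classic t -> `|g y - t| < d -> f (h t) <= f y.
Proof.
move=> cX cK cf e0 ch cg gA.
have [d d0 hd] := segment_uniformly_continuous ch e0.
exists d => // y t [p [q [yp yq]]] yA t1 yt.
have hX := @metric_hausdorff _ X.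
have cS x' q' : closed (sublevel K f e x' q').
  apply: closedI => //.
  have -> : [set z | f z <= f x' /\ e <= mdist q' z] =
    f @^-1` [set r | r <= f x'] `&` (fun z => mdist q' z) @^-1` [set r | e <= r].
    by [].
  apply: closedI; apply: closed_comp.
  - by move=> z _; exact: cf.
  - exact: closed_le.
  - by move=> z _; exact: mdistl_continuous.
  - exact: closed_ge.
have SK x' q' : sublevel K f e x' q' `<=` K by move=> z [].
set B1 := linked (sublevel K f e y q) y.
set B2 := linked (sublevel K f e y p) y.
have B1A : B1 `<=` A by move=> z /(linkedS (SK _ _)); exact: yA.
have B2A : B2 `<=` A by move=> z /(linkedS (SK _ _)); exact: yA.
have itv (B : set X) : connected B -> B `<=` A -> is_interval (g @` B).
  move=> cB BA; apply/connected_intervalP/connected_continuous_connected => //.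
  exact: continuous_subspaceW cg.
have i1 : is_interval (g @` B1) by apply: itv => //; exact: connected_linked_set.
have i2 : is_interval (g @` B2) by apply: itv => //; exact: connected_linked_set.
have [Sy Sp _] := yp; have [Sy' Sq _] := yq.
have B1y : B1 y by exact: linked_refl.
have B2y : B2 y by exact: linked_refl.
have gB (B : set X) z s : is_interval (g @` B) -> B `<=` A -> B y -> B z ->
    (g y <= s <= g z) || (g z <= s <= g y) -> B (h s).
  move=> iB BA By Bz /orP[] sP.
    have [w Bw <-] := iB _ _ (imageP g By) (imageP g Bz) _ sP.
    by rewrite (gA _ (BA _ Bw)).2.
  have [w Bw <-] := iB _ _ (imageP g Bz) (imageP g By) _ sP.
  by rewrite (gA _ (BA _ Bw)).2.
have far z : A z -> e <= mdist z y -> d <= `|g y - g z|.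
  move=> Az ez; rewrite leNgt; apply/negP => zy.
  have Ay := B1A _ B1y.
  have := hd _ _ (gA _ Ay).1 (gA _ Az).1 zy.
  rewrite (gA _ Ay).2 (gA _ Az).2 metric_sym; lra.
have Ap := B1A _ yp; have Aq := B2A _ yq.
have dp := far _ Ap Sy'.2.2; have dq := far _ Aq Sy.2.2.
have nB1q : ~ B1 q by move=> [_ [_ [_]]]; rewrite mdistxx; lra.
have nB2p : ~ B2 p by move=> [_ [_ [_]]]; rewrite mdistxx; lra.
(* p and q lie on opposite sides of y along A *)
have nqp : ~ ((g y <= g q <= g p) || (g p <= g q <= g y)).
  by move=> /(gB B1 _ _ i1 B1A B1y yp); rewrite (gA _ Aq).2.
have npq : ~ ((g y <= g p <= g q) || (g q <= g p <= g y)).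
  by move=> /(gB B2 _ _ i2 B2A B2y yq); rewrite (gA _ Ap).2.
have [] : (g y <= t <= g p) || (g p <= t <= g y) \/
    (g y <= t <= g q) || (g q <= t <= g y).
  move: yt dp dq nqp npq; rewrite ltr_norml => /andP[].
  have [?|?] := lerP (g y) (g p); have [?|?] := lerP (g y) (g q); 
    have [?|?] := lerP (g p) (g q); have [?|?] := lerP (g y) t;
    rewrite ?ler_norml => *; try lra.
- by move=> /(gB B1 _ _ i1 B1A B1y yp) [_ [_ []]].
- by move=> /(gB B2 _ _ i2 B2A B2y yq) [_ [_ []]].
Qed.

(** Two peaks whose parameters differ by less than the size of the window
   dominate each other, so that they have the same value. *)
Lemma peak_values_finite K f e A x0 : compact [set: X] -> closed K ->
  continuous f -> 0 < e -> is_arc A -> linked K x0 `<=` A ->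
  finite_set (f @` (peak K f e `&` linked K x0)).
Proof.
move=> cX cK cf e0 [h hA] DA.
have [g [ch cg _ gA]] := arc_coordinate hA.
have [d d0 hd] := peak_window cX cK cf e0 ch cg gA.
set E := peak K f e `&` linked K x0.
pose N := (Num.truncn d^-1).+1.
have N0 : 0 < N%:R :> R by rewrite ltr0n.
have Nd : N%:R^-1 < d.
  by rewrite -[d]invrK ltf_pV2 ?posrE ?invr_gt0// truncnS_gt.
pose k y := Num.truncn (g y * N%:R).
have inA y : E y -> A y by move=> [_ /DA].
have win y t : E y -> `[0, 1]%classic t -> `|g y - t| < d -> f (h t) <= f y.
  move=> [py yD]; apply: hd => // z yz; apply: DA; exact: linked_trans yz.
have same y z : E y -> E z -> k y = k z -> f y = f z.
  move=> Ey Ez kyz.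
  have [] := gA _ (inA _ Ey); have [] := gA _ (inA _ Ez).
  rewrite /= !in_itv/= => /andP[gz0 gz1] hgz /andP[gy0 gy1] hgy.
  have yz : `|g y - g z| < N%:R^-1.
    have := truncn_itv (mulr_ge0 gy0 (ltW N0)).
    have := truncn_itv (mulr_ge0 gz0 (ltW N0)).
    rewrite -/(k y) -/(k z) -kyz -!(@natr1 _ (k y)) => /andP[z1 z2] /andP[y1 y2].
    rewrite -[N%:R^-1]mul1r ltr_pdivlMr// -[X in _ * X](gtr0_norm N0) -normrM.
    by rewrite mulrBl ltr_norml; apply/andP; split; lra.
  have dyz := lt_trans yz Nd.
  apply/le_anti/andP; split.
    by rewrite -{1}hgy; apply: win => //; rewrite /= ?in_itv/= ?gy0// distrC.
  by rewrite -{1}hgz; apply: win => //; rewrite /= in_itv/= gz0.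
apply: (@sub_finite_set _ _ ((fun m => f (xget x0 [set y | E y /\ k y = m])) @` `I_N.+1)).
  move=> _ [y Ey <-]; exists (k y).
    have [] := gA _ (inA _ Ey); rewrite /= in_itv/= => /andP[gy0 gy1] _.
    by rewrite /k /= ltnS truncn_le_nat (le_lt_trans (ler_piMl _ gy1)) ?ler0n ?ltr_nat.
  have [Ez kz] := @xgetPex _ x0 [set z | E z /\ k z = k y] (ex_intro _ y (conj Ey erefl)).
  exact: same.
by apply: finite_image; exact: finite_II.
Qed.

(** * Subcontinua of a fan *)

(** If [C] met two legs, its intersection with their union would be a connected
   set cut into two closed pieces by the absence of [v]. *)
Lemma continuum_in_leg (v : X) (LL : set (set X)) C :
  (forall L, LL L -> is_arc L) -> \bigcup_(L in LL) L = [set: X] ->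
  (forall L L', LL L -> LL L' -> L <> L' -> L `&` L' = [set v]) ->
  (forall H K : set X, is_continuum H -> is_continuum K -> connected (H `&` K)) ->
  is_continuum C -> ~ C v -> exists2 L, LL L & C `<=` L.
Proof.
move=> arcLL covLL interLL unicoh contC nCv; have [[x Cx] _ _] := contC.
have cover y : exists2 L, LL L & L y.
  by have : [set: X] y by []; rewrite -covLL => -[L LLL Ly]; exists L.
have [L LLL Lx] := cover x; exists L => // y Cy; apply: contrapT => nLy.
have [L' LLL' L'y] := cover y.
have LL' : L <> L' by move=> E; apply: nLy; rewrite E.
have LL'v := interLL _ _ LLL LLL' LL'.
have [L0 cL coL] := arc_continuum (arcLL _ LLL).
have [L'0 cL' coL'] := arc_continuum (arcLL _ LLL').
have contLL' : is_continuum (L `|` L').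
  split; first by exists x; left.
  - exact: compactU.
  - by apply: connectedU => //; rewrite LL'v; exists v.
have hX := @metric_hausdorff _ X.
have disj z : C z -> L z -> ~ L' z.
  move=> Cz Lz L'z; have : (L `&` L') z by [].
  by rewrite LL'v => zv; apply: nCv; rewrite -zv.
have coC := unicoh _ _ contC contLL'.
have E : C `&` L = C `&` (L `|` L').
  apply: coC; first by exists x.
  - exists (~` L'); first by apply: closed_openC; exact: compact_closed.
    apply/seteqP; split => [z [Cz Lz]|z [[Cz [Lz|L'z]] nL'z] //].
    by split; [split => //; left|exact: disj].
  - exists L; first exact: compact_closed.
    by apply/seteqP; split => [z [Cz Lz]|z [[Cz _] Lz] //]; split=> //; split=> //; left.
have : (C `&` (L `|` L')) y by split=> //; right.
by rewrite -E => -[].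
Qed.

End peaks.

(** * Locally constant functions avoiding given values *)

Section locally_constant.
Context {X : topologicalType}.
Implicit Types (K A : set X).

Definition locally_constant (S : Type) K (c : X -> S) :=
  forall x, K x -> \forall y \near x, K y -> c y = c x.

Lemma locally_constant_connected (S : Type) K (c : X -> S) A x y :
  locally_constant K c -> connected A -> A `<=` K -> A x -> A y -> c y = c x.
Proof.
move=> lc cA AK Ax Ay.
have inI (P : S -> Prop) z : A z -> P (c z) -> [set t | K t -> P (c t)]° z.
  by move=> Az Pz; apply: filterS (lc z (AK _ Az)) => t ct /ct ->.
have E : A `&` [set t | c t = c x] = A.
  apply: cA; first by exists x.
  - exists [set t | K t -> c t = c x]°; first exact: open_interior.
    apply/seteqP; split => [t [At ct]|t [At /interior_subset ct]]; split => //.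
      exact: (inI (fun s => s = c x)).
    exact: ct (AK _ At).
  - exists (~` [set t | K t -> c t <> c x]°); first exact/open_closedC/open_interior.
    apply/seteqP; split => [t [At ct]|t [At nt]]; split => //.
      by move=> /interior_subset /(_ (AK _ At)).
    by apply: contrapT => ct; apply: nt; exact: (inI (fun s => s <> c x)).
by move: Ay; rewrite -E => -[].
Qed.

Lemma locally_constant_if (S : Type) K (N : set X) (c d : X -> S) :
  locally_constant K N -> locally_constant K c -> locally_constant K d ->
  locally_constant K (fun x => if pselect (N x) then c x else d x).
Proof.
move=> lN lc ld x Kx; near=> y => Ky.
have cyx : K y -> c y = c x by near: y; exact: lc.
have dyx : K y -> d y = d x by near: y; exact: ld.
have Nyx : K y -> N y = N x by near: y; exact: lN.
rewrite cyx// dyx//; move/(_ Ky) in Nyx.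
by case: pselect => Ny; case: pselect => Nx //; move: Ny; rewrite Nyx.
Unshelve. all: by end_near. Qed.

Lemma locally_constant_map2en K U V : open U -> open V -> U `&` V = set0 ->
  K `<=` U `|` V -> locally_constant K U.
Proof.
move=> oU oV UV KUV x Kx; have [Ux|Vx] := KUV _ Kx.
  apply: filterS (open_nbhs_nbhs (conj oU Ux)) => y Uy _.
  by apply/propext; split.
apply: filterS (open_nbhs_nbhs (conj oV Vx)) => y Vy _.
have dis z : U z -> V z -> False.
  by move=> Uz Vz; have : (U `&` V) z by []; rewrite UV.
by apply/propext; split => [/dis|/dis]; [move=> /(_ Vy)|move=> /(_ Vx)].
Qed.

Lemma locally_constant_comp (S S' : Type) K (c : X -> S) (g : S -> S') :
  locally_constant K c -> locally_constant K (g \o c).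
Proof. by move=> lc x Kx; apply: filterS (lc x Kx) => y cy Ky /=; rewrite cy. Qed.

Lemma locally_constant_map2 (S1 S2 S : Type) K (g : S1 -> S2 -> S) c d :
  locally_constant K c -> locally_constant K d ->
  locally_constant K (fun x => g (c x) (d x)).
Proof.
by move=> lc ld x Kx; apply: filterS2 (lc x Kx) (ld x Kx) => y cy dy Ky; rewrite cy ?dy.
Qed.

End locally_constant.

Lemma avoid_finite (R : realType) (E : set R) (c e : R) : 0 < e -> finite_set E ->
  exists2 s, `|s - c| <= e & ~ E s.
Proof.
move=> e0 fE; apply: contrapT => H.
pose u (n : nat) : R := c + e / n.+1%:R.
have injs : injective u.
  move=> m n /addrI /(mulfI (lt0r_neq0 e0)) /invr_inj /eqP.
  by rewrite eqr_nat eqSS => /eqP.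
have uE n : E (u n).
  apply: contrapT => nE; apply: H; exists (u n) => //.
  have en0 : 0 <= e / n.+1%:R by rewrite divr_ge0// ltW.
  by rewrite /u addrC addKr ger0_norm// ler_pdivrMr// ler_peMr ?ler1n ?ltW.
apply: infinite_nat.
apply: (@sub_finite_set _ _ (u @^-1` E)) => [n _|]; first exact: uE.
by apply: finite_preimage => // m n _ _; exact: injs.
Qed.

Section avoid.
Context {R : realType} {X : topologicalType}.
Context (cX : compact [set: X]).
Implicit Types (K T : set X) (f c : X -> R).

(** On the quasi-component of [x] the set [T] takes finitely many values, so a
   value [s] near [c x] is free; it remains free on a clopen neighbourhood by
   [linked_nbhs], and finitely many of these neighbourhoods are patched
   together. *)
Lemma locally_constant_avoid K T f c e : closed K -> closed T ->
  continuous f -> (forall x, K x -> finite_set (f @` (T `&` linked K x))) ->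
  locally_constant K c -> 0 < e ->
  exists c', [/\ locally_constant K c', forall x, K x -> `|c' x - c x| <= e &
    forall x, K x -> T x -> f x <> c' x].
Proof.
move=> cK cT cf finT lc e0.
have kK : compact K by apply: subclosed_compact cX _.
pose P S := exists N c', [/\ locally_constant K N, locally_constant K c',
  forall x, K x -> `|c' x - c x| <= e, forall x, K x -> S x -> N x &
  forall x, K x -> N x -> T x -> f x <> c' x].
suff [N [c' [lN lc' c'c KN Tc']]] : P K.
  by exists c'; split => // x Kx; apply: Tc' => //; exact: KN.
apply: compact_ideal => //.
- exists set0, c; split=> // x _; first by near=> y.
  by rewrite subrr normr0 ltW.
- by move=> A B AB [N [c' [lN lc' c'c KN Tc']]]; exists N, c'; split=> // x Kx /AB; exact: KN.
- move=> A B [N [c1 [lN lc1 c1c AN Tc1]]] [M [c2 [lM lc2 c2c BM Tc2]]].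
  exists (N `|` M), (fun x => if pselect (N x) then c1 x else c2 x); split.
  + exact: (locally_constant_map2 or).
  + exact: locally_constant_if.
  + by move=> x Kx; case: pselect => ?; [exact: c1c|exact: c2c].
  + by move=> x Kx [/(AN _ Kx)|/(BM _ Kx)]; [left|right].
  + move=> x Kx NMx Tx; case: pselect => Nx; first exact: Tc1.
    by apply: Tc2 => //; case: NMx.
- move=> x Kx.
  have [s sc ns] := avoid_finite (c x) e0 (finT x Kx).
  have oO : open (~` (T `&` [set y | f y = s])).
    apply: closed_openC; apply: closedI => //.
    apply: (@closed_comp _ _ f [set s]); last exact: closed_eq.
    by move=> y _; exact: cf.
  have xO : linked K x `<=` ~` (T `&` [set y | f y = s]).
    by move=> y xy [Ty fy]; apply: ns; exists y.
  have [U [V [oU oV UV KUV [Ux UO]]]] := linked_nbhs kK Kx oO xO.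
  pose N := U `&` [set y | c y = c x].
  have lN : locally_constant K N.
    apply: (locally_constant_map2 and); first exact: locally_constant_map2en KUV.
    exact: (locally_constant_comp (fun r => r = c x)).
  exists [set y | K y -> N y].
    by apply: filterS (lN x Kx) => y Nyx /Nyx ->.
  exists N, (fun y => if pselect (N y) then s else c y); split => //.
  + by apply: locally_constant_if => // y _; near=> z.
  + move=> y Ky; case: pselect => [[_ /= ->] //|?].
    by rewrite subrr normr0 ltW.
  + by move=> y Ky; exact.
  + move=> y Ky Ny Ty; case: pselect => // ? fy.
    by have := UO y (conj Ky Ny.1); apply.
Unshelve. all: by end_near. Qed.

(** The margin found here bounds the size of all later modifications in
   [avoid_countably_many]. *)
Lemma locally_constant_gap K T f c : closed T -> T `<=` K -> continuous f ->
  locally_constant K c -> (forall x, T x -> f x <> c x) ->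
  exists2 e, 0 < e & forall x, T x -> e < `|f x - c x|.
Proof.
move=> cT TK cf lc fc.
pose P S := exists2 e, 0 < e & forall x, T x -> S x -> e < `|f x - c x|.
suff [e e0 he] : P T by exists e => // x Tx; exact: he.
apply: compact_ideal.
- by apply: subclosed_compact cX _.
- by exists 1.
- by move=> A B AB [e e0 he]; exists e => // x Tx /AB; exact: he.
- move=> A B [e1 e10 he1] [e2 e20 he2]; exists (Num.min e1 e2).
    by rewrite lt_min e10 e20.
  by move=> x Tx [/(he1 _ Tx)|/(he2 _ Tx)]; rewrite gt_min => ->; rewrite ?orbT.
- move=> x Tx; pose e := `|f x - c x|.
  have e0 : 0 < e by rewrite normr_gt0 subr_eq0; exact/eqP/fc.
  have e20 : 0 < e / 2 by rewrite divr_gt0.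
  have /cvgrPdist_lt/(_ _ e20) fx := cf x.
  exists [set y | `|f x - f y| < e / 2 /\ (K y -> c y = c x)].
    by apply: filterI fx _; exact: lc (TK _ Tx).
  exists (e / 2) => // y Ty [fxy /(_ (TK _ Ty)) ->].
  have := ler_normD (f x - f y) (f y - c x).
  have -> : f x - f y + (f y - c x) = f x - c x by ring.
  rewrite -/e; lra.
Qed.

(** The approximation [cc n] comes with a radius [ee n] such that the limit stays
   within [ee n] of [cc n]. The step from [n] to [n.+1] avoids [T n] and takes
   the new radius below the margin, so the limit avoids [T n] as well. *)
Lemma avoid_countably_many K (T : nat -> set X) f (c0 e0 : R) : closed K ->
  (forall n, closed (T n)) -> (forall n, T n `<=` K) -> continuous f ->
  (forall n x, K x -> finite_set (f @` (T n `&` linked K x))) -> 0 < e0 ->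
  exists c : X -> R, [/\
    forall x, K x -> c @ within K (nbhs x) --> c x,
    forall A x y, connected A -> A `<=` K -> A x -> A y -> c y = c x,
    forall x, K x -> `|c x - c0| <= e0 &
    forall n x, T n x -> f x <> c x].
Proof.
move=> cK cT TK cf finT e00.
pose good (s : (X -> R) * R) := locally_constant K s.1 /\ 0 < s.2.
pose next n (s s' : (X -> R) * R) := [/\ s'.2 <= s.2 / 2,
  forall x, K x -> `|s'.1 x - s.1 x| <= s.2 / 2 &
  forall x, T n x -> s'.2 < `|f x - s'.1 x| ].
have step (ns : nat * ((X -> R) * R)) :
    exists s', good ns.2 -> good s' /\ next ns.1 ns.2 s'.
  case: ns => n [c e] /=; have [[/= lc ep]|ng] := pselect (good (c, e)); last first.
    by exists (c, e).
  have e20 : 0 < e / 2 by rewrite divr_gt0.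
  have [c' [lc' c'c Tc']] := locally_constant_avoid cK (cT n) cf (finT n) lc e20.
  have [d d0 hd] := locally_constant_gap (cT n) (@TK n) cf lc'
    (fun x Tx => Tc' x (@TK n x Tx) Tx).
  (* the radius is halved to sum the steps, and kept below the margin [d] *)
  exists (c', Num.min d (e / 2)) => _; split.
    by split=> //=; rewrite lt_min d0.
  split => //= [|x Tx]; first by rewrite ge_min lexx orbT.
  by rewrite gt_min hd.
have [F hF] := choice step.
pose u := fix u n := if n is m.+1 then F (m, u m) else (cst c0, e0).
have gu n : good (u n).
  elim: n => [|n IH]; last by have [] := hF (n, u n) IH.
  by split=> //= x _; near=> y.
have nu n : next n (u n) (u n.+1) by have [] := hF (n, u n) (gu n).
pose cc n := (u n).1; pose ee n := (u n).2.
have ee0 n : 0 < ee n by have [] := gu n.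
have eeS n : ee n.+1 <= ee n / 2 by have [] := nu n.
have ccS n x : K x -> `|cc n.+1 x - cc n x| <= ee n / 2 by have [_ + _] := nu n; apply.
have lo n m x : K x -> cc n x - ee n <= cc (n + m)%N x - ee (n + m)%N.
  move=> Kx; elim: m => [|m IH]; first by rewrite addn0.
  rewrite addnS; apply: le_trans IH _.
  have := ccS (n + m)%N x Kx; have := eeS (n + m)%N; rewrite ler_norml => ? /andP[]; lra.
have hi n m x : K x -> cc (n + m)%N x + ee (n + m)%N <= cc n x + ee n.
  move=> Kx; elim: m => [|m IH]; first by rewrite addn0.
  rewrite addnS; apply: le_trans IH.
  have := ccS (n + m)%N x Kx; have := eeS (n + m)%N; rewrite ler_norml => ? /andP[]; lra.
pose c x := sup (range (fun n => cc n x - ee n)).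
have cP n x : K x -> `|c x - cc n x| <= ee n.
  move=> Kx; have ubn m : cc m x - ee m <= cc n x + ee n.
    have := lo m n x Kx; have := hi n m x Kx; rewrite (addnC n m).
    have := ee0 (m + n)%N; lra.
  have h1 : cc n x - ee n <= c x.
    apply: ub_le_sup; last by exists n.
    by exists (cc n x + ee n) => _ [m _ <-].
  have h2 : c x <= cc n x + ee n.
    by apply: ge_sup => [|_ [m _ <-] //]; exists (cc 0%N x - ee 0%N), 0%N.
  rewrite ler_norml; apply/andP; split; lra.
have small d : 0 < d -> exists n, ee n < d.
  move=> d0; have bound n : ee n * n.+1%:R <= e0.
    elim: n => [|n IH]; first by rewrite mulr1.
    apply: le_trans IH; rewrite -natr1 -(natr1 n).
    have n0 : 0 <= n%:R :> R by rewrite ler0n.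
    have := eeS n; have := ee0 n; nra.
  exists (Num.truncn (e0 / d)).
  have := bound (Num.truncn (e0 / d)); rewrite -ler_pdivlMr ?ltr0n// => /le_lt_trans; apply.
  by rewrite ltr_pdivrMr ?ltr0n// mulrC -ltr_pdivrMr// truncnS_gt.
exists c; split.
- move=> x Kx; apply/cvgrPdist_lt => d d0.
  have [n nd] := small (d / 2) (divr_gt0 d0 (ltr0Sn _ _)).
  have [lcn _] := gu n.
  apply: filterS (lcn x Kx) => y + Ky => /(_ Ky); rewrite -/(cc n) => cyx.
  have := cP n x Kx; have := cP n y Ky; rewrite cyx !ler_norml ltr_norml.
  move=> /andP[? ?] /andP[? ?]; apply/andP; split; lra.
- move=> A x y cA AK Ax Ay; apply/eqP; rewrite -subr_eq0 -normr_le0.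
  apply/ler_addgt0Pl => d d0; rewrite addr0.
  have [n nd] := small (d / 2) (divr_gt0 d0 (ltr0Sn _ _)).
  have [lcn _] := gu n.
  have := locally_constant_connected lcn cA AK Ax Ay; rewrite -/(cc n) => E.
  have := cP n x (AK _ Ax); have := cP n y (AK _ Ay); rewrite E !ler_norml.
  move=> /andP[? ?] /andP[? ?]; apply/andP; split; lra.
- by move=> x Kx; exact: (cP 0%N).
- move=> n x Tx fcx; have [_ _ /(_ x Tx)] := nu n.
  by rewrite fcx ltNge cP//; exact: TK Tx.
Unshelve. all: by end_near. Qed.

End avoid.

(** * Pierced neighbourhoods *)

Section pierced.
Context {R : realType} {X : metricType R}.
Implicit Types (K A U O D : set X) (f c : X -> R).

Lemma closed_mdist_gap A q : closed A -> ~ A q ->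
  exists2 e : R, 0 < e & forall y, A y -> e <= mdist q y.
Proof.
move=> cA nAq.
have : nbhs q (~` A) by apply: open_nbhs_nbhs; split=> //; exact: closed_openC.
rewrite -metricType_numDomainType.filter_from_mdist_nbhs => -[e /= e0 he].
by exists e => // y Ay; rewrite leNgt; apply/negP => /he; exact.
Qed.

(** A maximum over a short piece of arc is a peak for some size: the two halves
   of the piece serve as links, and each is compact and misses the far end of
   the other because a parametrization is injective. *)
Lemma maximum_on_arc_peak K O f A x : continuous f -> open O -> O x -> O `<=` K ->
  is_arc A -> goes_through A x ->
  (forall B, connected B -> B `<=` A `&` O -> B x -> forall y, B y -> f y <= f x) ->
  exists n : nat, peak K f n.+1%:R^-1 x.
Proof.
move=> cf oO Ox OK [h hA] [Ax nendx] maxf.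
have [g [ch cg hI gA]] := arc_coordinate hA.
have [+ hsx] := gA x Ax; set s := g x in hsx *.
rewrite /= in_itv/= => /andP[s0 s1].
have s0' : 0 < s.
  rewrite lt_neqAle s0 andbT; apply/eqP => E; apply: nendx; exists h => //.
  by left; rewrite E.
have s1' : s < 1.
  rewrite lt_neqAle s1 andbT; apply/eqP => E; apply: nendx; exists h => //.
  by right; rewrite -E.
have [r r0 hr] : exists2 r : R, 0 < r &
    forall t : R, 0 <= t -> t <= 1 -> `|s - t| < r -> O (h t).
  have /subspace_continuousP/(_ s) := ch; rewrite /= in_itv/= s0 s1 => /(_ isT).
  have Os : O (h s) by rewrite hsx.
  move=> /(_ O (open_nbhs_nbhs (conj oO Os))) [r /= r0 hr].
  by exists r => // t t0 t1 st; apply: hr => //=; rewrite in_itv/= t0.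
pose w := Num.min (r / 2) (Num.min s (1 - s)).
have w0 : 0 < w by rewrite !lt_min divr_gt0//= s0' subr_gt0.
have [wr ws w1] : [/\ w <= r / 2, w <= s & w <= 1 - s].
  by rewrite /w !ge_min !lexx !orbT; split.
have side a b : s - w <= a -> b <= s + w ->
    [/\ connected (h @` `[a, b]), closed (h @` `[a, b]) & h @` `[a, b] `<=` A `&` O].
  move=> ha hb; have ch' : {within `[a, b], continuous h}.
    apply: continuous_subspaceW ch => t /=.
    by rewrite !in_itv/= => /andP[? ?]; apply/andP; split; lra.
  split.
  - by apply: connected_continuous_connected => //; exact: segment_connected.
  - apply: compact_closed; first exact: metric_hausdorff.
    by apply: continuous_compact => //; exact: segment_compact.
  - move=> _ [t /= + <-]; rewrite in_itv/= => /andP[ta tb]; split.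
      by apply: (hI t _).1; rewrite /= in_itv/=; apply/andP; split; lra.
    by apply: hr; [lra|lra|rewrite ltr_norml; apply/andP; split; lra].
have [co1 cl1 AO1] := side (s - w) s (lexx _) (ler_wpDr (ltW w0) (lexx _)).
have [co2 cl2 AO2] : [/\ connected (h @` `[s, s + w]), closed (h @` `[s, s + w]) &
    h @` `[s, s + w] `<=` A `&` O].
  by apply: side; lra.
have notin a b t : 0 <= a -> b <= 1 -> 0 <= t -> t <= 1 -> ~~ (a <= t <= b) ->
    ~ (h @` `[a, b]) (h t).
  move=> a0 b1 t0 t1 nt [t' /= + E]; rewrite in_itv/= => /andP[t'a t'b].
  have : g (h t') = g (h t) by rewrite E.
  rewrite (hI t' _).2 ?(hI t _).2 /= ?in_itv/= ?t0 ?t1//.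
    by move=> tt'; move: nt; rewrite -tt' t'a t'b.
  by apply/andP; split; lra.
have [e1 e10 he1] : exists2 e : R, 0 < e &
    forall y, (h @` `[s - w, s]) y -> e <= mdist (h (s + w)) y.
  apply: closed_mdist_gap => //; apply: notin; rewrite ?negb_and -?ltNge; try lra;
    by apply/orP; right; lra.
have [e2 e20 he2] : exists2 e : R, 0 < e &
    forall y, (h @` `[s, s + w]) y -> e <= mdist (h (s - w)) y.
  apply: closed_mdist_gap => //; apply: notin; rewrite ?negb_and -?ltNge; try lra;
    by apply/orP; left; lra.
pose n := Num.truncn (Num.min e1 e2)^-1.
have e0 : 0 < Num.min e1 e2 by rewrite lt_min e10.
have ne : n.+1%:R^-1 < Num.min e1 e2.
  by rewrite -[Num.min _ _]invrK ltf_pV2 ?posrE ?invr_gt0// truncnS_gt.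
move: ne; rewrite lt_min => /andP[ne1 ne2].
have x1 : (h @` `[s - w, s]) x by exists s => //=; rewrite in_itv/=; lra.
have x2 : (h @` `[s, s + w]) x by exists s => //=; rewrite in_itv/=; lra.
exists n, (h (s - w)), (h (s + w)); split.
- apply: (connected_linked co1) => //; last by exists (s - w) => //=; rewrite in_itv/=; lra.
  move=> y y1; split; first by apply: OK; have [] := AO1 _ y1.
  by split; [exact: maxf y1|exact: le_trans (ltW ne1) (he1 _ y1)].
- apply: (connected_linked co2) => //; last by exists (s + w) => //=; rewrite in_itv/=; lra.
  move=> y y2; split; first by apply: OK; have [] := AO2 _ y2.
  by split; [exact: maxf y2|exact: le_trans (ltW ne2) (he2 _ y2)].
Qed.

Lemma open_below K D f c : open D -> continuous f ->
  (forall x, K x -> c @ within K (nbhs x) --> c x) ->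
  (forall x, K x -> f x < c x -> \forall y \near x, K y \/ D y) ->
  open (D `|` [set x | K x /\ f x < c x]).
Proof.
move=> oD cf cc KD; rewrite openE => x [Dx|[Kx fcx]].
  by apply: filterS (open_nbhs_nbhs (conj oD Dx)) => y Dy; left.
pose m := (f x + c x) / 2.
have fm : f x < m by rewrite /m; lra.
have mc : m < c x by rewrite /m; lra.
have fy : \forall y \near x, f y < m by exact: (cvgr_lt _ (cf x)).
have cy : \forall y \near x, K y -> m < c y by exact: (cvgr_gt _ (cc x Kx)).
apply: filterS3 fy cy (KD x Kx fcx) => y fym cym [Ky|Dy]; last by left.
by right; split => //; exact: lt_trans fym (cym Ky).
Qed.

(** Of the fan only the following is used: the quasi-components of closed sets
   that miss the vertex are contained in arcs. The band [K] around the sphere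
   of centre [x0] is chosen to miss the vertex. *)
Lemma pierced_neighborhood (x0 v : X) (W : set X) : compact [set: X] ->
  (forall K x, closed K -> K x -> ~ K v ->
    exists2 L, is_arc L & linked K x `<=` L) ->
  nbhs x0 W -> exists U, [/\ open U, pierced U, U x0 & U `<=` W].
Proof.
move=> cX legs x0W.
have hX := @metric_hausdorff _ X.
have [r r0 rW] : exists2 r : R, 0 < r & forall y, mdist x0 y < r -> W y.
  by move: x0W; rewrite -metricType_numDomainType.filter_from_mdist_nbhs.
pose f := mdist x0.
have cf : continuous f by exact: mdistl_continuous.
have [a [b [a0 ab br nv]]] : exists a b : R,
    [/\ 0 < a, a < b, b < r & ~ (a <= f v /\ f v <= b)].
  have [fv0|fv0] := eqVneq (f v) 0.
    by exists (r / 3), (r / 2); rewrite fv0; split; lra.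
  have fv : 0 < f v by rewrite lt_neqAle eq_sym fv0 mdist_ge0.
  pose m := Num.min (f v) r.
  have m0 : 0 < m by rewrite lt_min fv r0.
  have [mv mr] : m <= f v /\ m <= r by rewrite /m !ge_min !lexx orbT.
  by exists (m / 3), (m / 2); split; lra.
pose K := [set y | a <= f y /\ f y <= b].
have cK : closed K.
  apply: (@closedI _ (f @^-1` [set t | a <= t]) (f @^-1` [set t | t <= b])).
    by apply: closed_comp; [move=> *; exact: cf|exact: closed_ge].
  by apply: closed_comp; [move=> *; exact: cf|exact: closed_le].
have cNf : continuous (\- f) by move=> z; apply: cvgN; exact: cf.
have e1 n : 0 < n.+1%:R^-1 :> R by rewrite invr_gt0.
pose T n := peak K f n.+1%:R^-1 `|` peak K (\- f) n.+1%:R^-1.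
have cT n : closed (T n) by apply: closedU; exact: closed_peak.
have TK n : T n `<=` K by move=> y [[p [q [[[]]]]]|[p [q [[[]]]]]].
have finT n x : K x -> finite_set (f @` (T n `&` linked K x)).
  move=> Kx; have [L arcL KL] := legs K x cK Kx nv.
  have fin1 := peak_values_finite cX cK cf (e1 n) arcL KL.
  have fin2 := peak_values_finite cX cK cNf (e1 n) arcL KL.
  apply: (@sub_finite_set _ _ (f @` (peak K f n.+1%:R^-1 `&` linked K x) `|`
    -%R @` ((\- f) @` (peak K (\- f) n.+1%:R^-1 `&` linked K x)))).
    move=> _ [y [[Ty|Ty] xy] <-]; first by left; exists y.
    by right; exists (- f y); [exists y|rewrite opprK].
  by rewrite finite_setU; split => //; exact: finite_image.
have e0 : 0 < (b - a) / 4 by lra.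
have [c [cc conc cab fc]] :=
  avoid_countably_many cX ((a + b) / 2) cK cT TK cf finT e0.
have ca x : K x -> a < c x < b.
  by move=> /cab; rewrite ler_norml => /andP[? ?]; apply/andP; split; lra.
pose U := [set y | f y < a] `|` [set y | K y /\ f y < c y].
pose E := [set y | b < f y] `|` [set y | K y /\ - f y < - c y].
have oU : open U.
  apply: open_below => //.
    by apply: (@open_comp _ _ f [set t | t < a]); [move=> *; exact: cf|exact: open_lt].
  move=> x Kx fcx; have /andP[_ cb] := ca x Kx.
  have /cvgr_lt/(_ _ (lt_trans fcx cb)) := cf x.
  apply: filterS => y fyb; have [?|?] := ltP (f y) a; first by right.
  by left; split => //; exact: ltW.
have oE : open E.
  apply: open_below => //.
  - by apply: (@open_comp _ _ f [set t | b < t]); [move=> *; exact: cf|exact: open_gt].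
  - by move=> x Kx; apply: cvgN; exact: cc.
  move=> x Kx; rewrite ltrN2 => fcx; have /andP[cax _] := ca x Kx.
  have /cvgr_gt/(_ _ (lt_trans cax fcx)) := cf x.
  apply: filterS => y fya; have [?|?] := ltP b (f y); first by right.
  by left; split => //; exact: ltW.
have UE : U `&` E = set0.
  rewrite -subset0 => y [[/= Uy|[[ya yb] Uy]] [/= Ey|[[? ?] Ey]]]; try lra.
exists U; split => //; last 2 first.
- by left; rewrite /= /f mdistxx.
- by move=> y [/= ?|[[_ ?] _]]; apply: rW; rewrite -/(f y); lra.
have clUE : closure U `<=` ~` E.
  have cE : closed (~` E) by exact: open_closedC.
  rewrite [~` E](closure_id _).1//; apply: closureS => y Uy Ey.
  by have : (U `&` E) y by []; rewrite UE.
move=> x bx; split => // V oV Vx A arcA Ax.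
have nUx : ~ U x.
  by have := bx.2; rewrite -(closure_id _).1//; exact: open_closedC.
have nEx : ~ E x by exact: clUE bx.1.
have Kx : K x.
  split; first by rewrite leNgt; apply/negP => fa; apply: nUx; left.
  by rewrite leNgt; apply/negP => fa; apply: nEx; left.
have fcx : f x = c x.
  apply/le_anti/andP; split; rewrite leNgt; apply/negP => fa.
    by apply: nEx; right; split => //; rewrite ltrN2.
  by apply: nUx; right.
pose O := V `&` [set y | a < f y /\ f y < b].
have oO : open O.
  apply: openI => //; apply: (@openI _ (f @^-1` [set t | a < t]) (f @^-1` [set t | t < b])).
    by apply: open_comp; [move=> *; exact: cf|exact: open_gt].
  by apply: open_comp; [move=> *; exact: cf|exact: open_lt].
have Ox : O x by split => //=; rewrite fcx; have /andP[] := ca x Kx.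
have OK : O `<=` K by move=> y [_ [/ltW ? /ltW]].
have cB B : connected B -> B `<=` A `&` O -> B x -> forall y, B y -> c y = c x.
  by move=> coB BO Bx y By; apply: (conc B) => // z /BO [_ /OK].
split; apply: contrapT => H.
- have [n pn] : exists n : nat, peak K (\- f) n.+1%:R^-1 x.
    apply: (maximum_on_arc_peak cNf oO Ox OK arcA Ax) => B coB BO Bx y By.
    have [Ay Oy] := BO _ By.
    rewrite /= lerN2 fcx -(cB B coB BO Bx y By) leNgt; apply/negP => fy.
    apply: H; exists y; split; first by split => //; exact: Oy.1.
    by right; split => //; exact: OK.
  by apply: (fc n x) => //; right.
- have [n pn] : exists n : nat, peak K f n.+1%:R^-1 x.
    apply: (maximum_on_arc_peak cf oO Ox OK arcA Ax) => B coB BO Bx y By.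
    have [Ay Oy] := BO _ By.
    rewrite fcx -(cB B coB BO Bx y By) leNgt; apply/negP => fy.
    apply: H; exists y; split; first by split => //; exact: Oy.1.
    by move=> /clUE; apply; right; split; [exact: OK|rewrite ltrN2].
  by apply: (fc n x) => //; left.
Qed.

End pierced.

Theorem corollary3 (R : realType) (X : metricType R) :
  is_fan X -> Jure_property X.
Proof.
move=> [[_ cX _] [v [LL [arcLL covLL interLL]]] unicoh].
have hX := @metric_hausdorff _ X.
exists [set U | open U /\ pierced U]; last by move=> U [].
split=> [U []//|x W xW].
have legs K y : closed K -> K y -> ~ K v ->
    exists2 L, is_arc L & linked K y `<=` L.
  move=> cK Ky nKv; have lK : linked K y `<=` K by move=> z [].
  have contK : is_continuum (linked K y).
    split; first by exists y; exact: linked_refl.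
    - by apply: subclosed_compact cX _ => //; exact: closed_linked.
    - exact: connected_linked_set.
  have [L LLL yL] := continuum_in_leg arcLL covLL interLL unicoh contK
    (contra_not (lK v) nKv).
  by exists L => //; exact: arcLL.
have [U [oU pU Ux UW]] := pierced_neighborhood cX legs xW.
by exists U.
Qed.
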